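(* Let $(A,\cdot)$ be an associative algebra over a field $K$ without zero divisors. Then for an associative product $*$ on $A$ the following are equivalent: (i) $*$ is $(12)$-matching with $\cdot$; (ii) $*$ is interchangeable with $\cdot$; (iii) $*$ is totally compatible with $\cdot$.
   Context: All algebras and vector spaces are over a field $K$ and all products are binary and bilinear; algebras are not assumed unital. For an associative product $*$ on $A$: - $*$ is $(12)$-matching with $\cdot$ if $(a*b)\cdot c=a\cdot(b*c)$ and $(a\cdot b)*c=a*(b\cdot c)$ for all $a,b,c\in A$; - $*$ is interchangeable with $\cdot$ if $(a*b)\cdot c=(a\cdot b)*c$ and $a*(b\cdot c)=a\cdot(b*c)$ for all $a,b,c\in A$; - $*$ is totally compatible with $\cdot$ if $(a*b)\cdot c=(a\cdot b)*c=a*(b\cdot c)=a\cdot(b*c)$ for all $a,b,c\in A$. *)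

(* Defs.v *)
From mathcomp Require Import all_boot all_algebra.

Set Implicit Arguments.
Unset Strict Implicit.
Unset Printing Implicit Defensive.

Import GRing.Theory.
Local Open Scope ring_scope.

(* MathComp's algebra structures are unital, so a possibly non-unital          *)
(* associative algebra is an lmodType with an associative bilinear product.    *)

Definition no_zero_divisors (A : nmodType) (mul : A -> A -> A) : Prop :=
  forall a b : A, mul a b = 0 -> a = 0 \/ b = 0.

Section Compatibility.

Variables (A : Type) (star mul : A -> A -> A).

Local Notation "a ** b" := (star a b) (at level 40, left associativity).
Local Notation "a \cdot b" := (mul a b) (at level 40, left associativity).

Definition matching12 : Prop :=
  forall a b c : A,
    (a ** b) \cdot c = a \cdot (b ** c) /\ (a \cdot b) ** c = a ** (b \cdot c).

Definition interchangeable_with : Prop :=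
  forall a b c : A,
    (a ** b) \cdot c = (a \cdot b) ** c /\ a ** (b \cdot c) = a \cdot (b ** c).

Definition totally_compatible : Prop :=
  forall a b c : A,
    [/\ (a ** b) \cdot c = (a \cdot b) ** c,
        (a \cdot b) ** c = a ** (b \cdot c)
      & a ** (b \cdot c) = a \cdot (b ** c)].

End Compatibility.

(* Main.v *)
Require Import Defs.
From mathcomp Require Import all_boot all_algebra.

Set Implicit Arguments.
Unset Strict Implicit.
Unset Printing Implicit Defensive.

Local Open Scope ring_scope.

(** Without zero divisors, two elements that agree after multiplication, on a
    fixed side, by every element are equal ([nzd_mul_injl], [nzd_mul_injr]).
    So each missing compatibility identity only has to be checked after
    multiplication by one extra element, and this extra factor gives the room
    to move [star] around a product of four elements.  Write juxtaposition for
    [mul] and [**] for [star].  If [**] is (12)-matching, then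
      x ((a b) ** c) = (x ** (a b)) c = ((x a) ** b) c = (x a) (b ** c)
                     = x (a (b ** c)) = x ((a ** b) c),
    so (a b) ** c = (a ** b) c.  If [**] is interchangeable, then
      ((a b) ** c) x = ((a b) c) ** x = (a (b c)) ** x = (a ** (b c)) x,
    so (a b) ** c = a ** (b c).  In each case the new equation identifies the
    two pairs of expressions that the hypothesis leaves apart, which gives
    total compatibility. *)

Section Cancellation.

Variables (K : fieldType) (A : lmodType K) (mul : {bilinear A -> A -> A}).
Hypothesis mul_nzd : no_zero_divisors mul.

(** The test element is the difference [u - v] itself, whose square vanishes;
    this covers the zero algebra too, where no nonzero factor exists. *)
Lemma nzd_mul_injl (u v : A) : (forall x, mul x u = mul x v) -> u = v.
Proof.
move=> uv; apply/eqP; rewrite -GRing.subr_eq0; apply/eqP.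
have /mul_nzd[] // : mul (u - v) (u - v) = 0.
by rewrite linearBr uv GRing.subrr.
Qed.

Lemma nzd_mul_injr (u v : A) : (forall x, mul u x = mul v x) -> u = v.
Proof.
move=> uv; apply/eqP; rewrite -GRing.subr_eq0; apply/eqP.
have /mul_nzd[] // : mul (u - v) (u - v) = 0.
by rewrite linearBl /= uv GRing.subrr.
Qed.

Hypothesis mulA : associative mul.
Variable star : A -> A -> A.

Lemma matching12_totally_compatible :
  matching12 star mul -> totally_compatible star mul.
Proof.
move=> m12.
have mul_star a b c : mul (star a b) c = mul a (star b c).
  by case: (m12 a b c).
have star_mul a b c : star (mul a b) c = star a (mul b c).
  by case: (m12 a b c).
have exch a b c : mul (star a b) c = star (mul a b) c.
  apply: nzd_mul_injl => x.
  by rewrite -[RHS]mul_star -star_mul !mul_star mulA.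
by move=> a b c; split; rewrite -?star_mul -?mul_star ?exch.
Qed.

Lemma interchangeable_totally_compatible :
  interchangeable_with star mul -> totally_compatible star mul.
Proof.
move=> itc.
have exchl a b c : mul (star a b) c = star (mul a b) c.
  by case: (itc a b c).
have exchr a b c : star a (mul b c) = mul a (star b c).
  by case: (itc a b c).
move=> a b c; split=> //.
by apply: nzd_mul_injr => x; rewrite !exchl mulA.
Qed.

End Cancellation.

Theorem proposition4p1 (K : fieldType) (A : lmodType K)
  (mul : {bilinear A -> A -> A}) (mulA : associative mul)
  (mul_nzd : no_zero_divisors mul)
  (star : {bilinear A -> A -> A}) (starA : associative star) :
  [<-> matching12 star mul;
       interchangeable_with star mul;
       totally_compatible star mul].
Proof.
tfae.
- move=> /(matching12_totally_compatible mul_nzd mulA) tc a b c.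
  by have [] := tc a b c.
- exact: interchangeable_totally_compatible.
- by move=> tc a b c; have [-> -> ->] := tc a b c.
Qed.
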